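(* Suppose that $h_i\equiv0$ for all $i\in\mathcal V$, each $f_i$ is convex, $L_i$-smooth for some $L_i>0$, and bounded from below, and the problem $\min_{x\in\mathbb{R}^d}\sum_{i\in\mathcal V}f_i(x)$ has a non-empty and bounded optimal solution set, with optimal value $F_{\mathrm{opt}}$. Let $L=\max_{i\in\mathcal V}L_i$. Then there is a constant $C\ge0$, depending only on the functions $f_i$ and the constants $L_i$ ($i\in\mathcal V$) and not on $\alpha$ or $W$, such that for every positive definite averaging matrix $W$ associated with $\mathcal G$ and every $\alpha>0$, the fixed point set of DGD-ATC (with parameters $\alpha$ and $W$) is non-empty and every fixed point $\mathbf{x}^\star=((x_1^\star)^T,\dots,(x_n^\star)^T)^T\in\mathbb{R}^{nd}$ satisfies $$F(\mathbf{x}^\star)\le F_{\mathrm{opt}},\qquad \|x_i^\star-\bar x^\star\|\le C\,\frac{\alpha}{1-\beta}\ \ \forall i\in\mathcal V,\qquad F(\bar{\mathbf{x}}^\star)\le F_{\mathrm{opt}}+C\left(\frac{\alpha}{1-\beta}+\frac{L\alpha^2}{2(1-\beta)^2}\right),$$ where $\beta=\max\{|\lambda_2(W)|,|\lambda_n(W)|\}\in[0,1)$, $\bar x^\star=\frac1n\sum_{i\in\mathcal V}x_i^\star$ and $\bar{\mathbf{x}}^\star=\mathbf{1}_n\otimes\bar x^\star$.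
   Context: $\mathcal G=(\mathcal V,\mathcal E)$ is an undirected connected graph with vertex set $\mathcal V=\{1,\dots,n\}$, $n\ge2$; $\mathcal E$ contains no self-loops. For each $i\in\mathcal V$, $f_i:\mathbb{R}^d\to\mathbb{R}$. A differentiable function $f$ is $L$-smooth if $\|\nabla f(y)-\nabla f(x)\|\le L\|y-x\|$ for all $x,y$. For $\mathbf{x}=(x_1^T,\dots,x_n^T)^T\in\mathbb{R}^{nd}$ with $x_i\in\mathbb{R}^d$, put $F(\mathbf{x})=f(\mathbf{x})=\sum_{i}f_i(x_i)$ (as all $h_i\equiv0$). A matrix $W=(w_{ij})\in\mathbb{R}^{n\times n}$ is an averaging matrix associated with $\mathcal G$ if it is symmetric and doubly stochastic (non-negative, rows and columns sum to 1), and $w_{ij}>0$ if $\{i,j\}\in\mathcal E$ or $i=j$, and $w_{ij}=0$ otherwise. $\mathbf{W}=W\otimes I_d$. $\lambda_i(W)$ denotes the $i$-th largest eigenvalue of $W$. $\mathbf{1}_n$ is the all-one vector. DGD-ATC with step-size $\alpha>0$ is the iteration $\mathbf{x}^{k+1}=\mathbf{W}(\mathbf{x}^k-\alpha\nabla f(\mathbf{x}^k))$; a fixed point is $\mathbf{x}^\star$ with $\mathbf{x}^\star=\mathbf{W}(\mathbf{x}^\star-\alpha\nabla f(\mathbf{x}^\star))$. *)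

(* Defs.v *)
From HB Require Import structures.
From mathcomp Require Import all_boot all_order all_algebra.
From mathcomp Require Import all_classical all_reals all_analysis.
From mathcomp Require Import polyrcf mxtens.

Set Implicit Arguments.
Unset Strict Implicit.
Unset Printing Implicit Defensive.

Import Order.TTheory GRing.Theory Num.Theory.
Import numFieldNormedType.Exports.

Local Open Scope classical_set_scope.
Local Open Scope ring_scope.

(* The Euclidean norm; the library norm `|x| on matrices is the sup norm. The
   two are equivalent, so differentiability and boundedness are the usual ones. *)
Definition enorm (R : realType) (m : nat) (x : 'cV[R]_m) : R :=
  Num.sqrt (\sum_(j < m) x j 0 ^+ 2).

Definition gradient (R : realType) (m : nat) (f : 'cV[R]_m -> R)
    (x : 'cV[R]_m) : 'cV[R]_m :=
  \col_j 'D_(delta_mx j 0) f x.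

Definition smooth (R : realType) (m : nat) (L : R) (f : 'cV[R]_m -> R) : Prop :=
  (forall x, differentiable f x) /\
  (forall x y, enorm (gradient f y - gradient f x) <= L * enorm (y - x)).

Definition argmin (R : realType) (m : nat) (f : 'cV[R]_m -> R) :
    set 'cV[R]_m :=
  [set x | forall y, f x <= f y].

Definition averaging_matrix (R : realType) (n : nat) (e : rel 'I_n)
    (W : 'M[R]_n) : Prop :=
  [/\ W^T = W,
      forall i j, 0 <= W i j,
      forall i, \sum_j W i j = 1,
      forall j, \sum_i W i j = 1 &
      forall i j, (e i j || (i == j) -> 0 < W i j) /\
                  (~~ (e i j || (i == j)) -> W i j = 0)].

(* To be used together with the symmetry of A. *)
Definition posdef (R : realType) (n : nat) (A : 'M[R]_n) : Prop :=
  forall x : 'cV[R]_n, x != 0 -> 0 < (x^T *m A *m x) 0 0.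

(* The real eigenvalues of A in decreasing order, each repeated according to its
   multiplicity as a root of the characteristic polynomial. When A is symmetric
   this sequence has length n. *)
Definition eigenvalues (R : realType) (n : nat) (A : 'M[R]_n) : seq R :=
  sort (fun x y => y <= x)
    (flatten [seq nseq (mup x (char_poly A)) x | x <- rootsR (char_poly A)]).

(* The i-th largest eigenvalue, with i counted from 1. *)
Definition lambda (R : realType) (n : nat) (i : nat) (A : 'M[R]_n) : R :=
  nth 0 (eigenvalues A) i.-1.

Definition beta (R : realType) (n : nat) (W : 'M[R]_n) : R :=
  Num.max `|lambda 2%N W| `|lambda n W|.

(* The component x_i in R^d of a stacked vector x in R^(nd). *)
Definition block (R : realType) (n d : nat) (x : 'cV[R]_(n * d)) (i : 'I_n) :
    'cV[R]_d :=
  \col_j x (mxtens_index (i, j)) 0.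

Definition stack_fun (R : realType) (n d : nat) (f : 'I_n -> 'cV[R]_d -> R)
    (x : 'cV[R]_(n * d)) : R :=
  \sum_i f i (block x i).

Definition average (R : realType) (n d : nat) (x : 'cV[R]_(n * d)) : 'cV[R]_d :=
  n%:R^-1 *: \sum_i block x i.

Definition consensus (R : realType) (n d : nat) (v : 'cV[R]_d) :
    'cV[R]_(n * d) :=
  tensmx (const_mx 1 : 'cV[R]_n) v.

Definition dgd_atc (R : realType) (n d : nat) (f : 'I_n -> 'cV[R]_d -> R)
    (alpha : R) (W : 'M[R]_n) (x : 'cV[R]_(n * d)) : 'cV[R]_(n * d) :=
  tensmx W (1%:M : 'M[R]_d) *m (x - alpha *: gradient (stack_fun f) x).

Definition dgd_atc_fixed_points (R : realType) (n d : nat)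
    (f : 'I_n -> 'cV[R]_d -> R) (alpha : R) (W : 'M[R]_n) :
    set 'cV[R]_(n * d) :=
  [set x | x = dgd_atc f alpha W x].

(* Main.v *)
(* Write a stacked vector as the n x d matrix X whose i-th row is x_i, and let
   G = G(X) be the matrix of the local gradients. Since W (x) I_d acts as left
   multiplication by W, fixed points are the solutions of X = W (X - alpha G),
   that is, the critical points of the convex function
     Phi(X) = F(X) + 1/(2 alpha) <X, (W^-1 - I) X>.
   - Existence: W^-1 - I dominates I - W, so the sublevel sets of Phi have bounded
     deviation from the mean; the mean itself is bounded because a convex function
     with a bounded set of minimizers has bounded sublevel sets. Hence Phi attains
     its minimum, and the descent lemma shows that its gradient vanishes there.
   - F(X) <= Fopt: convexity at X, as the rows of G sum to 0 and
     alpha <G, X> = |W Z|^2 - <Z, W Z> <= 0 for Z = X - alpha G.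
   - Then |G|^2 <= 2 L (F(X) - sum_i inf f_i) is bounded independently of alpha
     and W, and (I - W) X = - alpha W G yields
     (1 - gamma) |X - mean| <= alpha |G|, where gamma is the maximum of the
     Rayleigh quotient of W on the orthogonal complement of 1. This gamma is an
     eigenvalue distinct from 1, so that gamma <= lambda_2 <= beta. The last
     bound is the descent lemma at X.
   - beta < 1: since W is positive definite, this amounts to lambda_2 < 1, i.e. to
     1 being a simple root of the characteristic polynomial. *)

Require Import Defs.
From HB Require Import structures.
From mathcomp Require Import all_boot all_order all_algebra.
From mathcomp Require Import all_classical all_reals all_analysis.
From mathcomp Require Import polyrcf mxtens ring lra.

Set Implicit Arguments.
Unset Strict Implicit.
Unset Printing Implicit Defensive.

Import Order.TTheory GRing.Theory Num.Theory.
Import numFieldNormedType.Exports.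

Local Open Scope classical_set_scope.
Local Open Scope ring_scope.

(** * Frobenius inner product and compactness *)

Section FrobeniusProduct.
Context {R : realType}.

(** The Frobenius inner product. In trace form, symmetry and passing a factor to the other side
    ([dot_mulmxl]) follow from transposition and associativity alone. *)
Definition dot p q (A B : 'M[R]_(p, q)) : R := \tr (A^T *m B).

Definition frob p q (A : 'M[R]_(p, q)) : R := Num.sqrt (dot A A).

Lemma dotE p q (A B : 'M[R]_(p, q)) : dot A B = \sum_i \sum_j A i j * B i j.
Proof.
rewrite /dot /mxtrace exchange_big; apply: eq_bigr => j _.
by rewrite mxE; apply: eq_bigr => i _; rewrite mxE.
Qed.

Lemma dotC p q (A B : 'M[R]_(p, q)) : dot A B = dot B A.
Proof. by rewrite /dot -mxtrace_tr trmx_mul trmxK. Qed.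

Lemma dotDr p q (A B C : 'M[R]_(p, q)) : dot A (B + C) = dot A B + dot A C.
Proof. by rewrite /dot mulmxDr mxtraceD. Qed.

Lemma dotZr p q a (A B : 'M[R]_(p, q)) : dot A (a *: B) = a * dot A B.
Proof. by rewrite /dot -scalemxAr mxtraceZ. Qed.

Lemma dotNr p q (A B : 'M[R]_(p, q)) : dot A (- B) = - dot A B.
Proof. by rewrite -scaleN1r dotZr mulN1r. Qed.

Lemma dotBr p q (A B C : 'M[R]_(p, q)) : dot A (B - C) = dot A B - dot A C.
Proof. by rewrite dotDr dotNr. Qed.

Lemma dotDl p q (A B C : 'M[R]_(p, q)) : dot (A + B) C = dot A C + dot B C.
Proof. by rewrite dotC dotDr !(dotC C). Qed.

Lemma dotZl p q a (A B : 'M[R]_(p, q)) : dot (a *: A) B = a * dot A B.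
Proof. by rewrite dotC dotZr dotC. Qed.

Lemma dotNl p q (A B : 'M[R]_(p, q)) : dot (- A) B = - dot A B.
Proof. by rewrite dotC dotNr dotC. Qed.

Lemma dotBl p q (A B C : 'M[R]_(p, q)) : dot (A - B) C = dot A C - dot B C.
Proof. by rewrite dotDl dotNl. Qed.

Lemma dot0r p q (A : 'M[R]_(p, q)) : dot A 0 = 0.
Proof. by rewrite -(scale0r A) dotZr mul0r. Qed.

Definition dot_lin := (dotDl, dotDr, dotNl, dotNr, dotZl, dotZr).

Lemma dot_mulmxl p q r (W : 'M[R]_(r, p)) (A : 'M[R]_(p, q)) B :
  dot (W *m A) B = dot A (W^T *m B).
Proof. by rewrite /dot trmx_mul mulmxA. Qed.

Lemma dot_ge0 p q (A : 'M[R]_(p, q)) : 0 <= dot A A.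
Proof.
by rewrite dotE; do 2!apply: sumr_ge0 => ? _; rewrite -expr2 sqr_ge0.
Qed.

Lemma dot_eq0 p q (A : 'M[R]_(p, q)) : (dot A A == 0) = (A == 0).
Proof.
apply/idP/eqP => [|->]; last by rewrite dot0r.
have sq0 i j : 0 <= A i j * A i j by rewrite -expr2 sqr_ge0.
rewrite dotE psumr_eq0 => [/allP /= h|i _]; last exact: sumr_ge0.
apply/matrixP => i j; rewrite mxE.
have /eqP/psumr_eq0P /= := h i (mem_index_enum i).
by move/(_ (fun j _ => sq0 i j) j isT)/eqP; rewrite -expr2 sqrf_eq0 => /eqP.
Qed.

Lemma dot_gt0 p q (A : 'M[R]_(p, q)) : (0 < dot A A) = (A != 0).
Proof. by rewrite lt0r dot_eq0 dot_ge0 andbT. Qed.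

Lemma dot_add_le p q (A B : 'M[R]_(p, q)) :
  dot (A + B) (A + B) <= 2 * (dot A A + dot B B).
Proof. have := dot_ge0 (A - B); rewrite !dot_lin; lra. Qed.

Lemma dot_young p q (A B : 'M[R]_(p, q)) :
  - dot A B <= 2^-1 * (dot A A + dot B B).
Proof. have := dot_ge0 (A + B); rewrite !dot_lin (dotC B A); lra. Qed.

Lemma sqr_frob p q (A : 'M[R]_(p, q)) : frob A ^+ 2 = dot A A.
Proof. by rewrite sqr_sqrtr ?dot_ge0. Qed.

Lemma frob_ge0 p q (A : 'M[R]_(p, q)) : 0 <= frob A.
Proof. exact: sqrtr_ge0. Qed.

Lemma enormE m (x : 'cV[R]_m) : enorm x = frob x.
Proof.
rewrite /frob dotE /enorm; congr Num.sqrt; apply: eq_bigr => i _.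
by rewrite big_ord1 expr2.
Qed.

Lemma dot_le_frob p q (A B : 'M[R]_(p, q)) : dot A B <= frob A * frob B.
Proof.
have [->|A0] := eqVneq A 0.
  by rewrite dotC dot0r mulr_ge0 ?frob_ge0.
(* Cauchy-Schwarz: this vector is |A|^2 times the component of B orthogonal to A. *)
have := dot_ge0 ((frob A ^+ 2) *: B - dot A B *: A).
rewrite !dot_lin -sqr_frob -sqr_frob (dotC B A).
have fA : 0 < frob A by rewrite sqrtr_gt0 dot_gt0.
set a := frob A in fA *; set b := frob B; set c := dot A B => h.
have b0 : 0 <= b by exact: frob_ge0.
have {h} : 0 <= a ^+ 2 * ((a * b) ^+ 2 - c ^+ 2) by move: h; lra.
rewrite pmulr_rge0 ?exprn_gt0// subr_ge0 => h.
have := ler_norm c; have : `|c| <= a * b.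
  by rewrite -ler_sqr ?nnegrE ?mulr_ge0 ?frob_ge0// real_normK// num_real.
by move=> ? ?; lra.
Qed.

Lemma dot_sum_col p q (A B : 'M[R]_(p, q)) :
  dot A B = \sum_j dot (col j A) (col j B).
Proof.
rewrite dotE exchange_big; apply: eq_bigr => j _; rewrite dotE.
by apply: eq_bigr => i _; rewrite big_ord1 !mxE.
Qed.

Lemma dot_sum_row p q (A B : 'M[R]_(p, q)) :
  dot A B = \sum_i dot (row i A)^T (row i B)^T.
Proof.
rewrite dotE; apply: eq_bigr => i _; rewrite dotE; apply: eq_bigr => j _.
by rewrite big_ord1 !mxE.
Qed.

(** First-order optimality without differentiation: at t = - s a with s = 1 / (1 + |b|), the
    quadratic equals - s a^2 (1 - s b), which is negative unless a = 0, because s b <= 1 - s. *)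
Lemma quadratic_ge0_linear_coef (a b : R) :
  (forall t, 0 <= t * a + t ^+ 2 * b) -> a = 0.
Proof.
move=> h; apply/eqP; apply: contraT => a0.
pose s := (1 + `|b|)^-1.
have d0 : 0 < 1 + `|b| by rewrite ltr_pwDl.
have s0 : 0 < s by rewrite invr_gt0.
have sb : s * b <= 1 - s.
  have -> : 1 - s = s * `|b| by rewrite /s; field; rewrite gt_eqF.
  by rewrite ler_wpM2l ?ler_norm// ltW.
have a2 : 0 < a ^+ 2 by rewrite exprn_even_gt0.
have := h (- s * a).
have -> : - s * a * a + (- s * a) ^+ 2 * b = - (s * a ^+ 2 * (1 - s * b)) by ring.
have : 0 < s * a ^+ 2 * (1 - s * b) by apply: mulr_gt0; [exact: mulr_gt0|lra].
by move=> ? ?; lra.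
Qed.

End FrobeniusProduct.

(** * Norm comparison, continuity and attainment of minima on matrix spaces *)

Section Compactness.
Context {R : realType}.

Lemma norm_coord p q (A : 'M[R]_(p, q)) i j : `|A i j| <= `|A|.
Proof.
rewrite [leRHS]/Num.Def.normr /= mx_normrE.
by apply/bigmax_geP; right => /=; exists (i, j).
Qed.

Lemma norm_le_frob p q (A : 'M[R]_(p, q)) : `|A| <= frob A.
Proof.
rewrite [leLHS]/Num.Def.normr /= mx_normrE.
apply/bigmax_leP; split=> [|[i j] _ /=]; first exact: frob_ge0.
rewrite -ler_sqr ?nnegrE ?frob_ge0// sqr_frob dotE real_normK ?num_real//.
rewrite (bigD1 i)//= (bigD1 j)//= -expr2 -addrA lerDl addr_ge0//.
  by apply: sumr_ge0 => k _; rewrite -expr2 sqr_ge0.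
by do 2!apply: sumr_ge0 => ? _; rewrite -expr2 sqr_ge0.
Qed.

Lemma dot_le_norm p q (A : 'M[R]_(p, q)) : dot A A <= `|A| ^+ 2 * (p * q)%:R.
Proof.
rewrite dotE (le_trans (y := \sum_(i < p) \sum_(j < q) `|A| ^+ 2))//.
  do 2!apply: ler_sum => ? _; rewrite -expr2 -real_normK ?num_real//.
  by rewrite ler_sqr ?nnegrE ?norm_coord.
by rewrite !sumr_const !card_ord -mulrnA mulr_natr mulnC.
Qed.

Lemma continuous_mx (T : topologicalType) p q (f : T -> 'M[R]_(p, q)) :
  (forall i j, continuous (fun x => f x i j)) -> continuous f.
Proof.
move=> cf x; apply/cvg_ballP => e e0.
have : \forall y \near x, forall i j, ball (f x i j) e (f y i j).
  apply: (filter_forall (f := fun i y => forall j, _)) => i.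
  apply: (filter_forall (f := fun j y => _)) => j.
  by move/cvg_ballP: (cf i j x); exact.
by apply: filterS => y /=.
Qed.

Lemma continuous_sum (T : topologicalType) (I : Type) (r : seq I)
    (f : I -> T -> R) :
  (forall i, continuous (f i)) -> continuous (fun x => \sum_(i <- r) f i x).
Proof.
move=> cf; elim: r => [|i r IH].
  by rewrite (funext (fun x => big_nil _ _ _ _)) => x; exact: cvg_cst.
rewrite (funext (fun x => big_cons _ _ _ _ _ _)).
by move=> x; apply: cvgD; [exact: cf|exact: IH].
Qed.

Lemma continuous_dot (T : topologicalType) p q (f g : T -> 'M[R]_(p, q)) :
  continuous f -> continuous g -> continuous (fun x => dot (f x) (g x)).
Proof.
move=> cf cg.
have coord (h : T -> 'M[R]_(p, q)) : continuous h ->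
    forall i j, continuous (fun x => h x i j).
  move=> ch i j x.
  apply: (@continuous_comp _ _ _ h (fun A : 'M[R]_(p, q) => A i j)).
    exact: ch.
  exact: coord_continuous.
rewrite (funext (fun x => dotE (f x) (g x))).
apply: (@continuous_sum _ _ _ (fun i x => \sum_j f x i j * g x i j)) => i.
apply: (@continuous_sum _ _ _ (fun j x => f x i j * g x i j)) => j x.
by apply: cvgM; exact: coord.
Qed.

Lemma continuous_mulmx p q r (W : 'M[R]_(r, p)) :
  continuous (fun A : 'M[R]_(p, q) => W *m A).
Proof.
apply: continuous_mx => i j; rewrite (funext (fun A => mxE _ _ i j)).
apply: (@continuous_sum _ _ _ (fun k (A : 'M[R]_(p, q)) => W i k * A k j)).
by move=> k A; exact: (cvgM (cvg_cst (W i k)) (@coord_continuous _ _ _ k j A)).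
Qed.

(** Flattening by [vec_mx] reduces this to row vectors, where closed bounded sets are compact; the
    bound on [dot x x] controls the sup norm by [norm_le_frob]. *)
Lemma EVT_min_mx p q (f : 'M[R]_(p, q) -> R) (A : set 'M[R]_(p, q)) :
  A !=set0 -> closed A -> (exists M, forall x, A x -> dot x x <= M) ->
  continuous f -> exists2 c, A c & forall x, A x -> f c <= f x.
Proof.
move=> [a Aa] clA [M AM] cf.
have cvec : continuous (@vec_mx R p q).
  apply: continuous_mx => i j; rewrite (funext (fun A => mxE _ _ i j)).
  exact: coord_continuous.
have bnd : bounded_set (@vec_mx R p q @^-1` A).
  exists (Num.sqrt M); split=> [|N MN v /AM vM]; first exact: num_real.
  apply: le_trans (ltW MN).
  have /le_trans -> // : `|v| <= frob (vec_mx v).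
    rewrite [leLHS]/Num.Def.normr /= mx_normrE.
    apply/bigmax_leP; split=> [|[i k] _ /=]; first exact: frob_ge0.
    case/mxvec_indexP: k => k l; rewrite ord1.
    have -> : v 0 (mxvec_index k l) = vec_mx v k l by rewrite mxE.
    exact: le_trans (norm_coord _ _ _) (norm_le_frob _).
  by rewrite ler_wsqrtr.
have cA : compact (@vec_mx R p q @^-1` A).
  apply: bounded_closed_compact => //; exact: preimage_closed.
have [||c /set_mem Ac cmin] := EVT_min_rV _ cA (f := f \o vec_mx).
- by exists (mxvec a) => /=; rewrite mxvecK.
- apply: continuous_subspaceT => x; apply: cvg_comp; [exact: cvec|exact: cf].
exists (vec_mx c) => // x Ax.
by have := cmin (mxvec x); rewrite /= mxvecK; apply; rewrite inE/= mxvecK.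
Qed.

End Compactness.

(** * Smooth convex functions *)

Section SmoothConvex.
Context {R : realType} {m : nat}.
Implicit Types (f : 'cV[R]_m -> R) (x v : 'cV[R]_m).

Lemma convex_functionP f : convex_function [set: convex_lmodType 'cV[R]_m] f ->
  forall (x y : 'cV[R]_m) (t : R), 0 <= t <= 1 ->
  f (t *: x + (1 - t) *: y) <= t * f x + (1 - t) * f y.
Proof.
move=> cf x y t /andP[t0 t1].
have := cf (Itv01 t0 t1) x y.
by rewrite !in_setE; exact.
Qed.

Lemma derive_dot_gradient f x v : differentiable f x ->
  'D_v f x = dot (gradient f x) v.
Proof.
move=> df; rewrite deriveE// {1}(matrix_sum_delta v) linear_sum dotE.
apply: eq_bigr => i _; rewrite !big_ord1 linearZ /= mxE deriveE//.
by rewrite mulrC.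
Qed.

Lemma is_derive_line f x v (t : R) : (forall y, differentiable f y) ->
  is_derive t 1 (fun s : R => f (x + s *: v)) (dot (gradient f (x + t *: v)) v).
Proof.
move=> df; rewrite -derive_dot_gradient//.
pose g (s : R) := f (x + s *: v).
have quotientE : (fun h : R => h^-1 *: ((g \o shift t) (h *: 1) - g t)) =
    (fun h => h^-1 *: ((f \o shift (x + t *: v)) (h *: v)
      - f (x + t *: v))).
  apply/funext => h /=; congr (_ *: (f _ - _)).
  by rewrite [h *: 1]mulr1 scalerDl addrCA addrA.
have dv : derivable f (x + t *: v) v by exact: diff_derivable.
split; first by rewrite /derivable quotientE.
by rewrite /derive quotientE.
Qed.

(** The mean value theorem for [phi], which is f along the segment minus the linear and quadratic
    terms of the bound: its derivative is nonpositive by Cauchy-Schwarz and the Lipschitz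
    gradient. *)
Lemma descent f L x v : smooth L f ->
  f (x + v) <= f x + dot (gradient f x) v + L / 2 * dot v v.
Proof.
move=> [df lip].
pose phi (t : R) := f (x + t *: v) - (t * dot (gradient f x) v
   + t ^+ 2 * (L / 2 * dot v v)).
pose dphi (t : R) := dot (gradient f (x + t *: v)) v
   - (dot (gradient f x) v + t * (L * dot v v)).
have dp (t : R) : is_derive t 1 phi (dphi t).
  have := is_derive_line x v t df => ?.
  rewrite /phi /dphi.
  apply: is_derive_eq.
  rewrite /GRing.scale /= !mulr1 !mulr0 !add0r; congr (_ - (_ + _)).
  by lra.
have [|c] := @MVT R phi dphi 0 1 ltr01 (fun t _ => dp t).
  by apply: derivable_within_continuous => t _; case: (dp t).
 rewrite in_itv /= => /andP[c0 c1].
rewrite /phi /dphi !scale0r !scale1r addr0 => h.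
suff : dot (gradient f (x + c *: v)) v - dot (gradient f x) v
    <= c * (L * dot v v).
  by move: h; lra.
rewrite -dotBl; apply: le_trans (dot_le_frob _ _) _.
rewrite -!enormE.
have := lip x (x + c *: v); rewrite addrAC subrr add0r !enormE => h1.
apply: (le_trans (y := L * frob (c *: v) * frob v)).
  by rewrite ler_wpM2r ?frob_ge0.
have -> : frob (c *: v) = c * frob v.
  rewrite /frob !dot_lin mulrA sqrtrM ?mulr_ge0 ?ltW// -expr2.
  by rewrite sqrtr_sqr gtr0_norm.
by rewrite -sqr_frob; lra.
Qed.

(** By convexity, the difference quotients for 0 < h <= 1 are at most f(x + v) - f(x); the bound
    passes to the limit from the right. *)
Lemma convex_gradient_le f x v : (forall y, differentiable f y) ->
  convex_function [set: convex_lmodType 'cV[R]_m] f ->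
  f x + dot (gradient f x) v <= f (x + v).
Proof.
move=> df /convex_functionP cf; rewrite -lerBrDl.
rewrite -derive_dot_gradient//.
have dv : derivable f x v by exact: diff_derivable.
apply: (@cvgr_to_le _ (0 : R)^'+ _ _
  (fun h => h^-1 *: ((f \o shift x) (h *: v) - f x))).
  apply: cvg_trans dv; apply: cvg_app.
  by move=> A [e e0 Ae]; exists e => // y ye /gt_eqF/negbT; exact: Ae.
near=> h.
have h0 : 0 < h by [].
have h1 : h <= 1 by near: h; exact: nbhs_right_le.
rewrite /= [_ *: _]mulrC ler_pdivrMr// (addrC (h *: v)).
have := cf (x + v) x h; rewrite ltW// h1 => /(_ isT).
have -> : h *: (x + v) + (1 - h) *: x = x + h *: v.
  by rewrite scalerBl scalerDr scale1r addrC addrA subrK.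
by lra.
Unshelve. all: by end_near.
Qed.

(** One gradient step of length 1/L decreases f by at least |g|^2 / (2L), yet cannot go below
    [lb]. *)
Lemma dot_gradient_le f L lb x : 0 < L -> smooth L f -> (forall y, lb <= f y) ->
  dot (gradient f x) (gradient f x) <= 2 * L * (f x - lb).
Proof.
move=> L0 sf lbf; set g := gradient f x.
have := descent x (- L^-1 *: g) sf; rewrite -/g.
have := lbf (x + - L^-1 *: g).
rewrite !dot_lin; set y := f (_ + _); set G := dot g g => h1 h2.
have : lb <= f x - (2 * L)^-1 * G.
  apply: le_trans h1 (le_trans h2 _).
  rewrite le_eqVlt; apply/orP; left; apply/eqP; field; lra.
rewrite lerBrDl -lerBrDr mulrC ler_pdivrMr; last by lra.
by rewrite mulrC.
Qed.

End SmoothConvex.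

(** * Bounded sublevel sets of convex functions *)

Section Coercivity.
Context {R : realType} {m : nat}.

(* With eps > 0 the gap between min F and the minimum of F on a sphere enclosing
   the minimizers, convexity makes F grow at least at rate eps / r outside it. *)
Lemma sublevel_bounded (F : 'cV[R]_m -> R) x0 :
  (forall (x y : 'cV[R]_m) (t : R), 0 <= t <= 1 ->
     F (t *: x + (1 - t) *: y) <= t * F x + (1 - t) * F y) ->
  continuous F -> argmin F x0 -> bounded_set (argmin F) ->
  forall M, exists rho, forall x, F x <= M -> dot (x - x0) (x - x0) <= rho.
Proof.
move=> cvx cF minx0 [B [_ bB]] M.
have [r r0 rP] : exists2 r : R, 0 < r & forall x, argmin F x -> frob (x - x0) < r.
  (* [K] bounds the sup norm of x - x0 for every minimizer x; adding 1 to the resulting Euclidean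
     bound puts all minimizers strictly inside the sphere. *)
  pose K := `|B| + 1 + `|x0|.
  have K0 : 0 <= K ^+ 2 * (m * 1)%:R by rewrite mulr_ge0 ?sqr_ge0.
  exists (Num.sqrt (K ^+ 2 * (m * 1)%:R) + 1) => [|x mx].
    by rewrite ltr_wpDl ?sqrtr_ge0.
  rewrite ltr_pwDr// ler_wsqrtr//; apply: le_trans (dot_le_norm _) _.
  rewrite ler_wpM2r// ler_sqr ?nnegrE ?addr_ge0//.
  apply: le_trans (ler_normB _ _) _; rewrite lerD2r.
  by apply: bB => //; rewrite ltr_pwDr ?ler_norm.
pose S := [set x : 'cV[R]_m | dot (x - x0) (x - x0) = r ^+ 2].
have toS x : r < frob (x - x0) -> S (x0 + (r / frob (x - x0)) *: (x - x0)).
  move=> rx; rewrite /S /= [x0 + _ - x0]addrAC subrr add0r.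
  rewrite dotZl dotZr -sqr_frob; field.
  by rewrite gt_eqF// (lt_trans r0).
(* If the sphere is empty (as for m = 0), radial projection shows that no point lies outside the
   ball, so r^2 bounds everything. *)
have [S0|/set0P/negP/negPn/eqP S0] := pselect (S !=set0); last first.
  exists (r ^+ 2) => x _; rewrite leNgt; apply/negP => rx.
  have /toS : r < frob (x - x0).
    by rewrite -ltr_sqr ?nnegrE ?frob_ge0 ?ltW// sqr_frob.
  by rewrite S0.
have cS : continuous (fun x : 'cV[R]_m => dot (x - x0) (x - x0)).
  have csub : continuous (fun x : 'cV[R]_m => x - x0).
    by move=> x; exact: (cvgB cvg_id (cvg_cst x0)).
  exact: continuous_dot.
have clS : closed S.
  have := preimage_closed (fun x _ => cS x) (@closed_eq _ (r ^+ 2)).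
  exact.
have [c Sc cmin] : exists2 c, S c & forall x, S x -> F c <= F x.
  apply: EVT_min_mx => //; exists ((r + frob x0) ^+ 2) => x /= Sx.
  have := dot_le_frob (x - x0) x0; rewrite dotBl.
  have -> : dot x x = r ^+ 2 + 2 * dot x x0 - dot x0 x0.
    by rewrite -Sx !dotBl !dotBr (dotC x0 x); ring.
  have -> : frob (x - x0) = r by rewrite /frob Sx sqrtr_sqr gtr0_norm.
  by rewrite -sqr_frob; lra.
have eps0 : F x0 < F c.
  rewrite lt_neqAle minx0 andbT; apply/eqP => e.
  have /rP : argmin F c by move=> y; rewrite -e.
  by rewrite /frob Sc sqrtr_sqr gtr0_norm// ltxx.
(* The second term solves F c - F x0 <= (r / |x - x0|) (M - F x0) for |x - x0|; the maximum with r
   covers the points inside the sphere. *)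
pose s := Num.max r (r * (M - F x0) / (F c - F x0)).
exists (s ^+ 2) => x xM.
rewrite -sqr_frob ler_sqr ?nnegrE ?frob_ge0//; last first.
  by rewrite le_max ltW.
rewrite le_max; case: leP => //= rx; rewrite ler_pdivlMr ?subr_gt0//.
have f0 : 0 < frob (x - x0) by exact: lt_trans rx.
have t01 : 0 <= r / frob (x - x0) <= 1.
  by rewrite divr_ge0 ?(ltW r0) ?(ltW f0)//= ler_pdivrMr// mul1r ltW.
have := cvx x x0 _ t01; set t := r / _ in t01 *.
have -> : t *: x + (1 - t) *: x0 = x0 + t *: (x - x0).
  by rewrite scalerBl scalerBr scale1r addrC addrAC addrA.
move=> h; have := le_trans (cmin _ (toS x rx)) h => {}h.
have {}h : F c - F x0 <= t * (M - F x0).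
  have : t * F x <= t * M by rewrite ler_wpM2l//; case/andP: t01.
  by lra.
have : frob (x - x0) * (F c - F x0) <= frob (x - x0) * (t * (M - F x0)).
  by rewrite ler_wpM2l// ltW.
by rewrite mulrA /t mulrCA divff ?gt_eqF// mulr1.
Qed.

End Coercivity.

(** * Averaging matrices *)

Section CharacteristicPolynomial.
Context {F : fieldType}.

Lemma char_poly_conj n (S T A : 'M[F]_n) : T *m S = 1%:M ->
  char_poly (T *m A *m S) = char_poly A.
Proof.
move=> TS; rewrite /char_poly /char_poly_mx.
have TSp : map_mx polyC T *m map_mx polyC S = 1%:M by rewrite -map_mxM TS map_mx1.
have -> : 'X%:M - map_mx polyC (T *m A *m S) =
    map_mx polyC T *m ('X%:M - map_mx polyC A) *m map_mx polyC S.
  rewrite mulmxBr mulmxBl !map_mxM mul_mx_scalar -scalemxAl TSp.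
  by rewrite scalemx1.
by rewrite !det_mulmx mulrAC -det_mulmx TSp det1 mul1r.
Qed.

Lemma char_poly_ublock m n (A : 'M[F]_m) (B : 'M[F]_(m, n)) (D : 'M[F]_n) :
  char_poly (block_mx A B 0 D) = char_poly A * char_poly D.
Proof.
rewrite /char_poly /char_poly_mx map_block_mx map_mx0 scalar_mx_block.
by rewrite opp_block_mx add_block_mx oppr0 addr0 det_ublock.
Qed.

End CharacteristicPolynomial.

(** * The decreasing sequence of real eigenvalues *)

Section EigenvalueSequence.
Context {R : realType} {n : nat}.
Implicit Types (A : 'M[R]_n) (mu : R).

Lemma mem_eigenvalues A mu : (mu \in eigenvalues A) = root (char_poly A) mu.
Proof.
have p0 : char_poly A != 0 by rewrite monic_neq0 ?char_poly_monic.
have rootsE x : (x \in rootsR (char_poly A)) = root (char_poly A) x.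
  by have := roots_on_rootsR p0; rewrite /roots_on => /(_ x); rewrite itv_boundlr.
rewrite mem_sort; apply/flatten_mapP/idP => [[x xr]|rmu].
  by rewrite mem_nseq => /andP[_ /eqP ->]; rewrite -rootsE.
by exists mu; rewrite ?rootsE// mem_nseq eqxx andbT -XsubC_dvd// dvdp_XsubCl.
Qed.

(** The roots are listed without repetition, so only the run of copies of [mu] contributes. With
    [averaging_mup1] this shows that 1 is listed at most once. *)
Lemma count_eigenvalues A mu :
  (count_mem mu (eigenvalues A) <= mup mu (char_poly A))%N.
Proof.
rewrite count_sort count_flatten -map_comp sumnE big_map.
rewrite (eq_bigr (fun x => if x == mu then mup x (char_poly A) else 0)%N);
  last first.
  move=> x _ /=; rewrite count_nseq /= eq_sym.
  by case: eqP => _; rewrite ?mul1n ?mul0n.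
have [r|r] := boolP (mu \in rootsR (char_poly A)).
  by rewrite (bigD1_seq mu) ?uniq_roots//= eqxx big1 ?addn0// => x /negPf ->.
rewrite big_seq big1// => x xr; case: eqP => // xm.
by rewrite xm (negPf r) in xr.
Qed.

Lemma sorted_eigenvalues A : sorted (fun x y => y <= x) (eigenvalues A).
Proof. by apply: sort_sorted => x y; exact: le_total. Qed.

(* Nonnegativity covers the out-of-range indices, where lambda is 0. *)
Lemma lambda_le A i j : (0 < i <= j)%N ->
  (forall mu, mu \in eigenvalues A -> 0 <= mu) ->
  lambda j A <= lambda i A.
Proof.
move=> /andP[i0 ij] pos; rewrite /lambda.
have nth_ge0 k : 0 <= nth 0 (eigenvalues A) k.
  have [h|h] := ltnP k (size (eigenvalues A)); last by rewrite nth_default.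
  by apply: pos; exact: mem_nth.
have [h|h] := ltnP j.-1 (size (eigenvalues A)); last by rewrite (nth_default _ h).
apply: (sorted_leq_nth _ _ 0 (sorted_eigenvalues A)) => //.
- by move=> x y z /= xy yz; exact: le_trans xy.
- by rewrite inE (leq_ltn_trans _ h)// -!subn1 leq_sub2r.
- by rewrite -!subn1 leq_sub2r.
Qed.

End EigenvalueSequence.

(** * Quadratic forms and spectral gap of an averaging matrix *)

Section AveragingMatrix.
Context {R : realType} {n : nat} (e : rel 'I_n) (W : 'M[R]_n).
Context (avgW : averaging_matrix e W) (conn : forall i j, connect e i j).
Context (posW : posdef W).

Local Notation ones := (const_mx 1 : 'cV[R]_n).

Lemma averaging_sym : W^T = W. Proof. by case: avgW. Qed.

Lemma averaging_ones : W *m ones = ones.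
Proof.
case: avgW => _ _ r1 _ _; apply/matrixP => i j; rewrite !mxE -[RHS](r1 i).
by apply: eq_bigr => k _; rewrite mxE mulr1.
Qed.

Lemma dot_mulmxC q (X Y : 'M[R]_(n, q)) : dot (W *m X) Y = dot X (W *m Y).
Proof. by rewrite dot_mulmxl averaging_sym. Qed.

Lemma dot_posdef q (X : 'M[R]_(n, q)) : 0 <= dot X (W *m X).
Proof.
rewrite dot_sum_col sumr_ge0// => j _.
rewrite (colE _ (W *m X)) -mulmxA -colE /dot /mxtrace big_ord1 mulmxA.
have [->|x0] := eqVneq (col j X) 0; first by rewrite mulmx0 mxE.
exact: ltW (posW x0).
Qed.

(** Expanding the squares, unit row and column sums turn each pure square term into [dot x x]. This
    Dirichlet form gives W <= I and detects the vectors fixed by W. *)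
Lemma laplacian (x : 'cV[R]_n) :
  dot x x - dot x (W *m x) = 2^-1 * \sum_i \sum_j W i j * (x i 0 - x j 0) ^+ 2.
Proof.
case: avgW => _ _ r1 c1 _.
have -> : \sum_i \sum_j W i j * (x i 0 - x j 0) ^+ 2 =
   \sum_i \sum_j W i j * x i 0 ^+ 2 + \sum_i \sum_j W i j * x j 0 ^+ 2
   - 2 * \sum_i \sum_j W i j * (x i 0 * x j 0).
  rewrite mulr_sumr -big_split -sumrB; apply: eq_bigr => i _ /=.
  rewrite mulr_sumr -big_split -sumrB; apply: eq_bigr => j _ /=; ring.
have -> : \sum_i \sum_j W i j * x i 0 ^+ 2 = dot x x.
  rewrite dotE; apply: eq_bigr => i _.
  by rewrite -mulr_suml r1 mul1r big_ord1 expr2.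
have -> : \sum_i \sum_j W i j * x j 0 ^+ 2 = dot x x.
  rewrite exchange_big dotE; apply: eq_bigr => i _.
  by rewrite -mulr_suml c1 mul1r big_ord1 expr2.
have -> : \sum_i \sum_j W i j * (x i 0 * x j 0) = dot x (W *m x).
  rewrite dotE; apply: eq_bigr => i _; rewrite big_ord1 mxE mulr_sumr.
  by apply: eq_bigr => j _; ring.
by field.
Qed.

Lemma dot_averaging_le q (X : 'M[R]_(n, q)) : dot X (W *m X) <= dot X X.
Proof.
case: avgW => _ W0 _ _ _; rewrite !dot_sum_col; apply: ler_sum => j _.
rewrite (colE _ (W *m X)) -mulmxA -colE.
rewrite -subr_ge0 laplacian mulr_ge0//.
by do 2!apply: sumr_ge0 => ? _; rewrite mulr_ge0 ?sqr_ge0.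
Qed.

(* Adds the nonnegativity of the form of W at X - W X to that of I - W at W X. *)
Lemma dot_mul_averaging_le q (X : 'M[R]_(n, q)) :
  dot (W *m X) (W *m X) <= dot X (W *m X).
Proof.
have := dot_posdef (X - W *m X); have := dot_averaging_le (W *m X).
rewrite mulmxBr !dot_lin -(dot_mulmxC X (W *m X)).
by lra.
Qed.

Lemma averaging_unitmx : W \in unitmx.
Proof.
rewrite unitmxE unitfE; apply/negP => /det0P[v v0 vW].
have : v^T != 0 by rewrite -trmx0 (inj_eq trmx_inj).
by move/posW; rewrite trmxK vW mul0mx mxE ltxx.
Qed.

Lemma frob_averaging_le q (X : 'M[R]_(n, q)) : frob (W *m X) <= frob X.
Proof.
rewrite ler_wsqrtr// (le_trans (dot_mul_averaging_le X))//.
exact: dot_averaging_le.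
Qed.

(** A vanishing sum of nonnegative terms makes x agree across every edge, where the weight is
    positive; connectivity spreads this to all vertices. *)
Lemma averaging_invariant_const (x : 'cV[R]_n) :
  dot x x <= dot x (W *m x) -> forall i j, x i 0 = x j 0.
Proof.
case: (avgW) => _ W0 _ _ We; rewrite -subr_le0 laplacian pmulr_rle0// => le0.
have term0 i j : 0 <= W i j * (x i 0 - x j 0) ^+ 2 by rewrite mulr_ge0 ?sqr_ge0.
have edge i j : e i j -> x i 0 = x j 0.
  move=> eij.
  have Wij : 0 < W i j by apply: (We i j).1; rewrite eij.
  have := le_trans _ le0.
  move=> /(_ (W i j * (x i 0 - x j 0) ^+ 2)); rewrite pmulr_rle0// => h.
  apply/eqP; rewrite -subr_eq0 -sqrf_eq0 eq_le sqr_ge0 andbT h//.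
  rewrite (bigD1 i)//= (bigD1 j)//= -addrA lerDl addr_ge0//.
    exact: sumr_ge0.
  by do 2!apply: sumr_ge0 => ? _.
move=> i j; have cl : fingraph.closed e [pred k | x k 0 == x i 0].
  by move=> k l /edge kl; rewrite !inE kl.
by have := closed_connect cl (conn i j); rewrite !inE eqxx => /esym/eqP.
Qed.

Lemma averaging_invariant_eq0 (x : 'cV[R]_n) :
  dot x x <= dot x (W *m x) -> dot ones x = 0 -> x = 0.
Proof.
move=> /averaging_invariant_const xc; rewrite dotE => x0.
apply/colP => i; rewrite mxE; apply/eqP.
have : \sum_(j < n) x i 0 = 0.
  rewrite -[RHS]x0; apply: eq_bigr => j _.
  by rewrite big_ord1 mxE mul1r; exact: xc.
have n0 : n%:R != 0 :> R by rewrite pnatr_eq0 -lt0n; case: (n) i => // -[].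
by rewrite sumr_const card_ord -mulr_natl => /eqP; rewrite mulf_eq0 (negPf n0).
Qed.

Lemma averaging_eigenvalue mu : mu \in eigenvalues W ->
  exists2 x : 'cV[R]_n, x != 0 & W *m x = mu *: x.
Proof.
rewrite mem_eigenvalues -eigenvalue_root_char => /eigenvalueP[v vW v0].
exists v^T; first by rewrite -trmx0 (inj_eq trmx_inj).
by rewrite -averaging_sym -trmx_mul vW linearZ.
Qed.

Lemma averaging_eigenvalue_itv mu : mu \in eigenvalues W -> 0 < mu <= 1.
Proof.
move=> /averaging_eigenvalue[x x0 Wx]; have := dot_averaging_le x.
have := posW x0; rewrite -mulmxA Wx -scalemxAr mxE dotZr.
have -> : (x^T *m x) 0 0 = dot x x by rewrite /dot /mxtrace big_ord1.
have xx : 0 < dot x x by rewrite dot_gt0.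
by rewrite pmulr_lgt0// ger_pMl// => -> ->.
Qed.

(** [gamma] is the maximum of the Rayleigh quotient on the unit sphere of the complement of 1. A
    maximizer is an eigenvector, and gamma >= 1 would force it to be constant with zero sum. *)
Lemma averaging_gap : (2 <= n)%N ->
  exists gamma, [/\ gamma < 1, gamma \in eigenvalues W &
    forall x : 'cV[R]_n, dot ones x = 0 -> dot x (W *m x) <= gamma * dot x x].
Proof.
move=> n2.
pose A := [set x : 'cV[R]_n | dot ones x = 0 /\ dot x x = 1].
have cid : continuous (@idfun 'cV[R]_n) by move=> x; exact: cvg_id.
have scaleA (x : 'cV[R]_n) : dot ones x = 0 -> x != 0 -> A ((frob x)^-1 *: x).
  move=> x1 x0; have fx : frob x != 0 by rewrite gt_eqF// sqrtr_gt0 dot_gt0.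
  by split; rewrite !dot_lin ?x1 ?mulr0// -sqr_frob; field.
have A0 : A !=set0.
  (* The difference of two basis vectors is orthogonal to 1, and it is nonzero because n >= 2. *)
  pose x : 'cV[R]_n := delta_mx (Ordinal (ltnW n2)) 0 - delta_mx (Ordinal n2) 0.
  exists ((frob x)^-1 *: x); apply: scaleA.
    have d1 i : dot ones (delta_mx i 0) = 1.
      rewrite dotE (bigD1 i)//= big_ord1 !mxE !eqxx mulr1 big1 ?addr0// => j ji.
      by rewrite big_ord1 !mxE (negPf ji) mulr0.
    by rewrite dotBr !d1 subrr.
  apply/eqP => /colP/(_ (Ordinal n2)); rewrite !mxE eqxx /= => /eqP.
  by rewrite sub0r oppr_eq0 oner_eq0.
have clA : closed A.
  apply: closedI.
    have c1 : continuous (fun x : 'cV[R]_n => dot ones x).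
      exact: (continuous_dot (fun=> @cvg_cst _ _ _ _ _) cid).
    exact: (preimage_closed (fun x _ => c1 x) (@closed_eq _ 0)).
  have c2 : continuous (fun x : 'cV[R]_n => dot x x) by exact: continuous_dot.
  exact: (preimage_closed (fun x _ => c2 x) (@closed_eq _ 1)).
have [||v [v1 vv] vmax] := EVT_min_mx A0 clA _ (f := fun x => - dot x (W *m x)).
- by exists 1 => x [_ ->].
- have c3 : continuous (fun x : 'cV[R]_n => dot x (W *m x)).
    by apply: continuous_dot => //; exact: continuous_mulmx.
  by move=> x; exact: cvgN (c3 x).
pose gamma := dot v (W *m v).
have rayleigh (x : 'cV[R]_n) : dot ones x = 0 ->
    dot x (W *m x) <= gamma * dot x x.
  move=> x1; have [->|x0] := eqVneq x 0; first by rewrite mulmx0 !dot0r mulr0.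
  have := vmax _ (scaleA x x1 x0); rewrite lerN2 -scalemxAr !dot_lin -/gamma.
  rewrite -sqr_frob mulrA -expr2 exprVn ler_pdivrMl 1?mulrC//.
  by rewrite exprn_gt0// sqrtr_gt0 dot_gt0.
have Wv : W *m v = gamma *: v.
  (* The residual u = gamma v - W v is orthogonal to 1, so v + t u obeys the Rayleigh bound for all
     t; the coefficient of t there is 2 |u|^2, hence zero. *)
  apply/esym/eqP; rewrite -subr_eq0; set u := _ - _.
  have Wones x : dot ones (W *m x) = dot ones x.
    by rewrite -[X in _ *m X]/x -{1}averaging_sym -dot_mulmxl averaging_ones.
  have u1 : dot ones u = 0 by rewrite dotBr Wones dotZr v1 mulr0 subr0.
  have uu : dot u u = gamma * dot u v - dot u (W *m v).
    by rewrite {2}/u dotBr dotZr.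
  rewrite -dot_eq0; apply/eqP; clearbody u.
  suff : 2 * dot u u = 0 by lra.
  apply: (@quadratic_ge0_linear_coef _ _ (gamma * dot u u - dot u (W *m u))) => t.
  have := rayleigh (v + t *: u).
  rewrite dotDr dotZr v1 u1 mulr0 addr0 => /(_ erefl).
  rewrite mulmxDr -scalemxAr !dot_lin -/gamma vv.
  have -> : dot v (W *m u) = dot u (W *m v).
    by rewrite dotC dot_mulmxl averaging_sym.
  by rewrite (dotC v u) uu; lra.
exists gamma; split=> //.
  rewrite ltNge; apply/negP => g1.
  have : v = 0 by apply: averaging_invariant_eq0 => //; rewrite vv.
  by move=> v0; move/eqP: vv; rewrite v0 dot0r eq_sym oner_eq0.
rewrite mem_eigenvalues -eigenvalue_root_char; apply/eigenvalueP; exists v^T.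
  by rewrite -[W]averaging_sym -trmx_mul Wv linearZ.
by rewrite -trmx0 (inj_eq trmx_inj) -dot_eq0 vv oner_eq0.
Qed.

Lemma averaging_gap_mx gamma q (X : 'M[R]_(n, q)) :
  (forall x : 'cV[R]_n, dot ones x = 0 -> dot x (W *m x) <= gamma * dot x x) ->
  ones^T *m X = 0 -> dot X (W *m X) <= gamma * dot X X.
Proof.
move=> gap X1.
rewrite !dot_sum_col mulr_sumr; apply: ler_sum => j _.
rewrite (colE _ (W *m X)) -mulmxA -colE; apply: gap.
by rewrite /dot colE mulmxA X1 mul0mx mxtrace0.
Qed.

End AveragingMatrix.

(** * Simplicity of the eigenvalue 1 and its consequences for beta *)

Section SecondEigenvalue.
Context {R : realType} {n : nat} (e : rel 'I_n) (W : 'M[R]_n).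
Context (n2 : (2 <= n)%N) (avgW : averaging_matrix e W).
Context (conn : forall i j, connect e i j) (posW : posdef W).

(* S has the eigenvector 1 of W as its first column, so T W S, with T = S^-1, is
   block upper triangular with corner 1. A left fixed vector of the lower block D
   gives a left fixed vector of W with zero sum, so 1 is no eigenvalue of D. *)
Lemma averaging_mup1 : (mup 1 (char_poly W) <= 1)%N.
Proof.
case: n n2 e W avgW conn => // n' _ e' V avgV conn'.
pose S : 'M[R]_(1 + n') := block_mx 1%:M 0 (const_mx 1) 1%:M.
pose T : 'M[R]_(1 + n') := block_mx 1%:M 0 (- const_mx 1) 1%:M.
have TS : T *m S = 1%:M.
  rewrite mulmx_block !mulmx1 !mul1mx !mul0mx !mulmx0 !addr0 !add0r addNr.
  by rewrite -scalar_mx_block.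
have one1 : const_mx 1 = 1%:M :> 'M[R]_1.
  by apply/matrixP => i j; rewrite !ord1 !mxE.
have onesE : const_mx 1 = col_mx 1%:M (const_mx 1) :> 'cV[R]_(1 + n').
  by rewrite -one1 col_mx_const.
pose M := T *m (V : 'M[R]_(1 + n')) *m S.
have Me : M *m col_mx 1%:M 0 = col_mx 1%:M 0 :> 'cV[R]_(1 + n').
  rewrite /M -mulmxA mul_block_col !mulmx1 !mulmx0 !addr0 -onesE.
  rewrite -mulmxA (averaging_ones avgV) onesE mul_block_col.
  by rewrite !mul1mx !mul0mx addr0 mulmx1 addNr.
have MB : M = block_mx 1%:M (ursubmx M) 0 (drsubmx M).
  rewrite -{1}[M]submxK; move: Me; rewrite -{1}[M]submxK mul_block_col.
  by rewrite !mulmx1 !mulmx0 !addr0 => /eq_col_mx[-> ->].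
rewrite -(char_poly_conj _ TS) -/M MB char_poly_ublock.
have -> : char_poly (1%:M : 'M[R]_1) = 'X - 1%:P.
  by rewrite /char_poly det_mx11 !mxE eqxx.
rewrite mupMl; first by rewrite -['X - _]expr1 mup_XsubCX eqxx.
rewrite -eigenvalue_root_char; apply/eigenvalueP => -[u uB u0].
pose z := row_mx 0 u *m T.
have zS : z *m S = row_mx 0 u by rewrite -mulmxA TS mulmx1.
have zV : z *m V = z.
  have ST : S *m T = 1%:M by exact: mulmx1C.
  have -> : z *m V = row_mx 0 u *m M *m T.
    by rewrite /M -!mulmxA ST mulmx1 !mulmxA.
  by rewrite MB mul_row_block !mul0mx mulmx0 !add0r uB scale1r.
have Vz : (V : 'M[R]_(1 + n')) *m z^T = z^T.
  by rewrite -(averaging_sym avgV) -trmx_mul zV.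
have z0 : z^T = 0.
  apply: (averaging_invariant_eq0 avgV conn'); first by rewrite Vz.
  rewrite /dot /mxtrace big_ord1.
  (* The vector 1 is the first column of [S], so the sum of [z] is the first entry of [z *m S],
     which is 0. *)
  have -> : (const_mx 1 : 'cV[R]_(1 + n'))^T *m z^T = (z *m S *m col_mx 1%:M 0)^T.
    rewrite -mulmxA mul_block_col !mulmx1 !mulmx0 !addr0 -onesE.
    by rewrite -trmx_mul.
  by rewrite zS mul_row_col mul0mx mulmx0 addr0 !mxE.
move: zS; rewrite -[z]trmxK z0 trmx0 mul0mx -row_mx0 => /eq_row_mx[_ /esym].
by move/eqP: u0.
Qed.

Lemma beta_lt1 : 0 <= beta W < 1.
Proof.
have pos mu : mu \in eigenvalues W -> 0 <= mu.
  by move=> /(averaging_eigenvalue_itv avgW posW)/andP[/ltW].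
have l2n : lambda n W <= lambda 2 W by exact: lambda_le.
have nth_ge0 k : 0 <= nth 0 (eigenvalues W) k.
  have [h|h] := ltnP k (size (eigenvalues W)); last by rewrite nth_default.
  by apply: pos; exact: mem_nth.
have l21 : lambda 2 W < 1.
  rewrite /lambda /=; have := sorted_eigenvalues W.
  have := leq_trans (count_eigenvalues W 1) averaging_mup1.
  have : forall mu, mu \in eigenvalues W -> mu <= 1.
    by move=> mu /(averaging_eigenvalue_itv avgW posW)/andP[].
  (* With fewer than two entries, lambda 2 is the default 0. Otherwise b = 1 would force a = 1 by
     sortedness, and 1 would be counted twice. *)
  case: (eigenvalues W) => [|a [|b s]] //= le1 cnt /andP[ba _].
  rewrite lt_neqAle le1 ?inE ?eqxx ?orbT// andbT.
  have a1 : a <= 1 by rewrite le1 ?inE ?eqxx.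
  apply/eqP => b1; move: cnt; rewrite b1 eqxx.
  by have -> : a = 1; [apply/eqP; rewrite eq_le a1 -b1|rewrite eqxx].
rewrite /beta !ger0_norm ?nth_ge0//.
by rewrite le_max nth_ge0 /= gt_max l21 (le_lt_trans l2n).
Qed.

(** The list is decreasing and contains 1, so [gamma] < 1 is not its head; lying in the tail, it is
    at most the second entry. *)
Lemma gap_le_beta gamma : gamma < 1 -> gamma \in eigenvalues W -> gamma <= beta W.
Proof.
move=> g1 gW; rewrite /beta le_max; apply/orP; left.
apply: le_trans (ler_norm _); rewrite /lambda /=.
have oneW : 1 \in eigenvalues W.
  rewrite mem_eigenvalues -eigenvalue_root_char; apply/eigenvalueP.
  exists (const_mx 1)^T; last first.
    apply/eqP => /rowP/(_ (Ordinal n2)); rewrite !mxE => /eqP.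
    by rewrite oner_eq0.
  rewrite -(averaging_sym avgW) -trmx_mul (averaging_ones avgW).
  by rewrite scale1r.
have := sorted_eigenvalues W.
have tr : transitive (fun x y : R => y <= x).
  by move=> x y z /= xy yz; exact: le_trans xy.
case: (eigenvalues W) gW oneW => [|a s]//; rewrite !inE /= => /orP gW oneW as_.
have as' : forall b, b \in s -> b <= a by exact/allP/(order_path_min tr as_).
case: gW => [/eqP ga|gs].
  move: g1; rewrite ga; case/orP: oneW => [/eqP <-|/as' oa].
    by rewrite ltxx.
  by rewrite ltNge oa.
case: s gs as_ {as' oneW} => [|b s]//; rewrite inE /= => /orP[/eqP -> //|gs].
by move=> /andP[_ /(order_path_min tr)/allP]; exact.
Qed.

End SecondEigenvalue.

(** * Stacked vectors as matrices *)

Section Stacking.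
Context {R : realType} {n d : nat}.
Implicit Types (f : 'I_n -> 'cV[R]_d -> R) (X V : 'M[R]_(n, d)).

Definition unstack (x : 'cV[R]_(n * d)) : 'M[R]_(n, d) :=
  \matrix_(i, j) x (mxtens_index (i, j)) 0.

Definition stack X : 'cV[R]_(n * d) :=
  \col_k X (mxtens_unindex k).1 (mxtens_unindex k).2.

Definition total f X : R := \sum_i f i (row i X)^T.

Definition gradients f X : 'M[R]_(n, d) :=
  \matrix_(i, j) gradient (f i) (row i X)^T j 0.

(** The rank-one form makes invariance under W a matter of associativity and W 1 = 1. *)
Definition replicate (c : 'cV[R]_d) : 'M[R]_(n, d) := const_mx 1 *m c^T.

Lemma stackK : cancel stack unstack.
Proof. by move=> X; apply/matrixP => i j; rewrite !mxE mxtens_indexK. Qed.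

Lemma unstackK : cancel unstack stack.
Proof.
move=> x; apply/colP => k; rewrite !mxE -[in RHS](mxtens_unindexK k).
by case: (mxtens_unindex k).
Qed.

Lemma blockE (x : 'cV[R]_(n * d)) i : block x i = (row i (unstack x))^T.
Proof. by apply/colP => j; rewrite !mxE. Qed.

Lemma stack_funE f x : stack_fun f x = total f (unstack x).
Proof. by apply: eq_bigr => i _; rewrite blockE. Qed.

Lemma row_replicate c i : (row i (replicate c))^T = c.
Proof.
by apply/colP => j; rewrite !mxE big_ord1 !mxE mul1r.
Qed.

Lemma dot_replicate_same c : dot (replicate c) (replicate c) = n%:R * dot c c.
Proof.
rewrite dot_sum_row (eq_bigr (fun=> dot c c)) => [|i _]; last first.
  by rewrite row_replicate.
by rewrite sumr_const card_ord mulr_natl.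
Qed.

Lemma replicateD c c' : replicate (c + c') = replicate c + replicate c'.
Proof. by rewrite /replicate linearD /= mulmxDr. Qed.

Lemma unstack_consensus c : unstack (consensus n c) = replicate c.
Proof.
apply/matrixP => i j; rewrite [RHS]mxE big_ord1 !mxE mxtens_indexK /=.
by rewrite !mul1r; congr (c _ _); exact: val_inj.
Qed.

Lemma is_derive_block (g : 'cV[R]_d -> R) i (x v : 'cV[R]_(n * d)) :
  differentiable g (block x i) ->
  is_derive x v (fun y => g (block y i)) ('D_(block v i) g (block x i)).
Proof.
move=> dg.
pose gi (y : 'cV[R]_(n * d)) := g (block y i).
have quotientE : (fun h : R => h^-1 *: ((gi \o shift x) (h *: v) - gi x)) =
    (fun h => h^-1 *: ((g \o shift (block x i))
      (h *: block v i) - g (block x i))).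
  apply/funext => h /=; congr (_ *: (g _ - _)).
  by apply/colP => j; rewrite !mxE.
have dv : derivable g (block x i) (block v i) by exact: diff_derivable.
by split; [rewrite /derivable quotientE|rewrite /derive quotientE].
Qed.

Lemma unstack_gradient f x : (forall i y, differentiable (f i) y) ->
  unstack (gradient (stack_fun f) x) = gradients f (unstack x).
Proof.
move=> df; apply/matrixP => i j; rewrite !mxE -blockE.
set v := delta_mx _ _.
have -> : stack_fun f = \sum_(k < n) (fun y => f k (block y k)).
  by apply/funext => y; rewrite fct_sumE.
have dk k : is_derive x v (fun y => f k (block y k))
    ('D_(block v k) (f k) (block x k)).
  exact: is_derive_block.
have -> : 'D_v (\sum_(k < n) (fun y => f k (block y k))) x =
    \sum_(k < n) 'D_(block v k) (f k) (block x k).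
  exact: derive_val.
(* The coordinate direction (i, j) moves only block i, so a single summand survives. *)
have bv k : block v k = if k == i then delta_mx j 0 else 0.
  apply/colP => l; rewrite !mxE eqxx andbT (can_eq (@mxtens_indexK n d)).
  by rewrite xpair_eqE; case: eqP => _; rewrite ?mxE ?eqxx ?andbT.
rewrite (bigD1 i)//= bv eqxx big1 ?addr0// => k /negPf ki.
by rewrite bv ki derive0.
Qed.

Lemma unstack_tensmx (W : 'M[R]_n) (x : 'cV[R]_(n * d)) :
  unstack (tensmx W 1%:M *m x) = W *m unstack x.
Proof.
apply/matrixP => i j; rewrite [LHS]mxE [LHS]mxE [RHS]mxE.
rewrite (reindex (@mxtens_index n d)) /=; last first.
  by exists (@mxtens_unindex n d) => k _; rewrite ?mxtens_indexK ?mxtens_unindexK.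
pose F k l := tensmx W 1%:M (mxtens_index (i, j)) (mxtens_index (k, l)) *
  x (mxtens_index (k, l)) 0.
rewrite (eq_bigr (fun p => F p.1 p.2)) => [|[]//]; rewrite -(pair_bigA _ F) /= /F.
apply: eq_bigr => k _; rewrite (bigD1 j)//= tensmxE !mxE eqxx mulr1 big1 ?addr0//.
by move=> l lj; rewrite tensmxE !mxE eq_sym (negPf lj) mulr0 mul0r.
Qed.

Lemma fixed_pointE f alpha W x : (forall i y, differentiable (f i) y) ->
  dgd_atc_fixed_points f alpha W x <->
  unstack x = W *m (unstack x - alpha *: gradients f (unstack x)).
Proof.
move=> df.
have E : unstack (dgd_atc f alpha W x) =
    W *m (unstack x - alpha *: gradients f (unstack x)).
  rewrite unstack_tensmx -unstack_gradient//; congr (_ *m _).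
  by apply/matrixP => i j; rewrite !mxE.
rewrite -E; split=> [xE|/(can_inj unstackK)//]; first by rewrite [in LHS]xE.
Qed.

Lemma row_gradients f X i :
  (row i (gradients f X))^T = gradient (f i) (row i X)^T.
Proof. by apply/colP => j; rewrite !mxE. Qed.

Lemma total_descent f (Li : 'I_n -> R) L X V :
  (forall i, smooth (Li i) (f i)) -> (forall i, Li i <= L) ->
  total f (X + V) <= total f X + dot (gradients f X) V + L / 2 * dot V V.
Proof.
move=> sf LiL; rewrite /total (dot_sum_row (gradients f X)) (dot_sum_row V).
rewrite mulr_sumr -!big_split; apply: ler_sum => i _ /=.
rewrite row_gradients !linearD /=; apply: le_trans (descent _ _ (sf i)) _.
by rewrite lerD2l ler_wpM2r ?dot_ge0// ler_pM2r.
Qed.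

Lemma total_gradient_le f X V : (forall i y, differentiable (f i) y) ->
  (forall i, convex_function [set: convex_lmodType 'cV[R]_d] (f i)) ->
  total f X + dot (gradients f X) V <= total f (X + V).
Proof.
move=> df cf; rewrite /total dot_sum_row -big_split; apply: ler_sum => i _ /=.
by rewrite row_gradients !linearD /=; exact: convex_gradient_le.
Qed.

Lemma dot_gradients_le f (Li : 'I_n -> R) L lb X :
  (forall i, 0 < Li i <= L) -> (forall i, smooth (Li i) (f i)) ->
  (forall i y, lb i <= f i y) ->
  dot (gradients f X) (gradients f X) <= 2 * L * (total f X - \sum_i lb i).
Proof.
move=> LiL sf lbf; rewrite dot_sum_row -sumrB mulr_sumr; apply: ler_sum => i _.
have /andP[Li0 LiLi] := LiL i.
rewrite row_gradients (le_trans (dot_gradient_le _ Li0 (sf i) (lbf i)))//.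
by rewrite ler_wpM2r ?subr_ge0// ler_pM2l.
Qed.

Lemma continuous_total f : (forall i y, differentiable (f i) y) ->
  continuous (total f).
Proof.
move=> df; apply: (@continuous_sum _ _ _ _ (fun i X => f i (row i X)^T)) => i.
have crow : continuous (fun X : 'M[R]_(n, d) => (row i X)^T).
  apply: continuous_mx => k l.
  rewrite (_ : (fun _ => _) = (fun X : 'M[R]_(n, d) => X i k)).
    exact: coord_continuous.
  by apply/funext => Y; rewrite !mxE.
have cf : continuous (f i).
  by move=> y; exact: differentiable_continuous.
by move=> X; exact: (continuous_comp (crow X) (cf _)).
Qed.

Definition mean X : 'cV[R]_d := n%:R^-1 *: (X^T *m const_mx 1).

Definition deviation X : 'M[R]_(n, d) := X - replicate (mean X).

Lemma average_unstack (x : 'cV[R]_(n * d)) : average x = mean (unstack x).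
Proof.
apply/colP => j; rewrite !mxE summxE; congr (_ * _); apply: eq_bigr => i _.
by rewrite !mxE mulr1.
Qed.

Lemma block_sub_average (x : 'cV[R]_(n * d)) i :
  enorm (block x i - average x) <= frob (deviation (unstack x)).
Proof.
rewrite enormE ler_wsqrtr// [leRHS]dot_sum_row.
have -> : block x i - average x = (row i (deviation (unstack x)))^T.
  by rewrite /deviation !linearB /= row_replicate -blockE average_unstack.
by rewrite (bigD1 i)//= lerDl sumr_ge0// => k _; exact: dot_ge0.
Qed.

Lemma ones_deviation X : (0 < n)%N ->
  (const_mx 1 : 'cV[R]_n)^T *m deviation X = 0.
Proof.
move=> n0; rewrite mulmxBr /replicate mulmxA.
have -> : (const_mx 1 : 'cV[R]_n)^T *m const_mx 1 = n%:R%:M :> 'M[R]_1.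
  apply/matrixP => i j; rewrite !ord1 !mxE.
  rewrite (eq_bigr (fun=> 1)) => [|k _]; last by rewrite !mxE mulr1.
  by rewrite sumr_const card_ord mulr1n.
rewrite mul_scalar_mx /mean [X in _ *: X]linearZ /= scalerA.
rewrite divff ?scale1r ?pnatr_eq0 -?lt0n//.
by rewrite trmx_mul trmxK subrr.
Qed.

Lemma dot_replicate X c : (const_mx 1 : 'cV[R]_n)^T *m X = 0 ->
  dot X (replicate c) = 0.
Proof.
by move=> X1; rewrite dotC /dot trmx_mul -mulmxA X1 mulmx0 mxtrace0.
Qed.

End Stacking.

(** * Fixed points *)

Section FixedPoints.
Context {R : realType} {n d : nat} (n2 : (2 <= n)%N).
Context (f : 'I_n -> 'cV[R]_d -> R) (Li : 'I_n -> R) (L : R) (lb : 'I_n -> R).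
Context (LiL : forall i, 0 < Li i <= L) (sf : forall i, smooth (Li i) (f i)).
Context (cf : forall i, convex_function [set: convex_lmodType 'cV[R]_d] (f i)).
Context (lbf : forall i y, lb i <= f i y).
Context (xo : 'cV[R]_d) (xo_min : argmin (fun x => \sum_i f i x) xo).
Context (argmin_bounded : bounded_set (argmin (fun x => \sum_i f i x))).
Context (e : rel 'I_n) (conn : forall i j, connect e i j) (W : 'M[R]_n).
Context (avgW : averaging_matrix e W) (posW : posdef W).
Context (gamma : R) (gamma_lt1 : gamma < 1).
Context (gap : forall x : 'cV[R]_n, dot (const_mx 1) x = 0 ->
  dot x (W *m x) <= gamma * dot x x).
Context (alpha : R) (alpha0 : 0 < alpha).

Local Notation ones := (const_mx 1 : 'cV[R]_n).
Local Notation Fmin := (\sum_i f i xo).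
Local Notation gap_value := (Fmin - \sum_i lb i).

Let df i y : differentiable (f i) y. Proof. by case: (sf i). Qed.

Let L0 : 0 < L.
Proof.
by have /andP[/lt_le_trans h /h] := LiL (Ordinal n2).
Qed.

Let Li_le i : Li i <= L. Proof. by case/andP: (LiL i). Qed.

Let total_replicate c : total f (replicate c) = \sum_i f i c.
Proof. by apply: eq_bigr => i _; rewrite row_replicate. Qed.

Lemma deviation_sub_mulmx (X : 'M[R]_(n, d)) :
  deviation X - W *m deviation X = X - W *m X.
Proof.
rewrite /deviation mulmxBr /replicate mulmxA (averaging_ones avgW).
by rewrite opprB addrA subrK.
Qed.

(** The columns of the deviation sum to 0, so the spectral gap applies to it, and removing the mean
    leaves (I - W) X unchanged. *)
Let gap_deviation (X : 'M[R]_(n, d)) :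
  (1 - gamma) * dot (deviation X) (deviation X)
  <= dot (deviation X) (X - W *m X).
Proof.
rewrite -deviation_sub_mulmx mulrBl mul1r [leRHS]dotBr lerB//.
by apply: averaging_gap_mx => //; apply: ones_deviation; exact: ltnW.
Qed.

(** The descent lemma from X in the direction of minus the deviation, which ends at the replicated
    mean. It serves both existence and the final bound. *)
Lemma total_mean_le (X : 'M[R]_(n, d)) : \sum_i f i (mean X) <=
  total f X - dot (gradients f X) (deviation X)
  + L / 2 * dot (deviation X) (deviation X).
Proof.
rewrite -total_replicate.
have -> : replicate (mean X) = X - deviation X by rewrite /deviation subKr.
have := total_descent X (- deviation X) sf Li_le.
by rewrite !dot_lin opprK.
Qed.

(** * Estimates at a fixed point *)

Section Bounds.
Context (X : 'M[R]_(n, d)).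
Local Notation G := (gradients f X).
Context (fixX : X = W *m (X - alpha *: G)).

(** Multiplying the fixed point equation by 1^T, which W preserves, leaves alpha 1^T G = 0. *)
Let ones_gradients : ones^T *m G = 0.
Proof.
have := congr1 (mulmx ones^T) fixX; rewrite mulmxA.
rewrite -{1}(averaging_sym avgW) -trmx_mul (averaging_ones avgW) mulmxBr.
rewrite -scalemxAr => /eqP; rewrite -subr_eq0 opprB addrC subrK scaler_eq0.
by rewrite gt_eqF//= => /eqP.
Qed.

Lemma fixed_point_total_le : total f X <= Fmin.
Proof.
have := total_gradient_le X (replicate xo - X) df cf.
rewrite (addrC X) subrK total_replicate dotBr (dot_replicate _ ones_gradients).
rewrite sub0r; apply: le_trans; rewrite lerDl oppr_ge0.
have := dot_mul_averaging_le avgW posW (X - alpha *: G).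
rewrite -fixX dotBl dotZl => h.
by rewrite -(pmulr_rle0 _ alpha0); lra.
Qed.

Lemma fixed_point_gradients_le :
  frob G <= Num.sqrt (2 * L * gap_value).
Proof.
rewrite ler_wsqrtr// (le_trans (dot_gradients_le _ LiL sf lbf))//.
by rewrite ler_wpM2l ?mulr_ge0 ?(ltW L0)// lerD2r fixed_point_total_le.
Qed.

(** Pair (I - W) X = - alpha W G with the deviation: the gap bounds this from below, Cauchy-Schwarz
    and the contractivity of W from above; then cancel one factor |deviation|. *)
Lemma fixed_point_deviation_le :
  frob (deviation X) * (1 - gamma) <= alpha * frob G.
Proof.
have [->|Y0] := eqVneq (deviation X) 0.
  by rewrite /frob dot0r sqrtr0 mul0r mulr_ge0 ?sqrtr_ge0// ltW.
have Y0' : 0 < frob (deviation X) by rewrite sqrtr_gt0 dot_gt0.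
rewrite -(ler_pM2l Y0'); have := gap_deviation X.
have -> : X - W *m X = - alpha *: (W *m G).
  by rewrite {1}fixX mulmxBr addrAC subrr add0r -scalemxAr scaleNr.
rewrite dotZr -(dot_mulmxC avgW) -sqr_frob => h.
have : dot (- (W *m deviation X)) G <= frob (deviation X) * frob G.
  apply: le_trans (dot_le_frob _ _) _; rewrite ler_wpM2r ?frob_ge0//.
  have -> : frob (- (W *m deviation X)) = frob (W *m deviation X).
    by rewrite /frob !dot_lin opprK.
  exact: (frob_averaging_le avgW posW).
rewrite dotNl => /(ler_wpM2l (ltW alpha0)).
by move: h; lra.
Qed.

End Bounds.

(** * Existence of a fixed point by minimizing [Phi] *)

Lemma fixed_point_exists : exists X : 'M[R]_(n, d),
  X = W *m (X - alpha *: gradients f X).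
Proof.
have Wu := averaging_unitmx posW.
pose V := invmx W - 1%:M.
have Vsym : V^T = V.
  by rewrite /V linearB /= trmx_inv (averaging_sym avgW) trmx1.
pose Phi (X : 'M[R]_(n, d)) := total f X + (2 * alpha)^-1 * dot X (V *m X).
pose A := [set X : 'M[R]_(n, d) | Phi X <= Fmin].
(* Since W V = I - W, this is the nonnegativity of the form of W at V X. *)
have dotV (X : 'M[R]_(n, d)) : dot X (X - W *m X) <= dot X (V *m X).
  have WVX : W *m (V *m X) = X - W *m X.
    by rewrite mulmxA mulmxBr mulmxV// mulmx1 mulmxBl mul1mx.
  have := dot_posdef posW (V *m X).
  rewrite WVX dotBr -(dot_mulmxC avgW (V *m X) X) WVX !(dotC _ X) subr_ge0.
  exact.
have dotV_ge0 (X : 'M[R]_(n, d)) : 0 <= dot X (V *m X).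
  apply: le_trans _ (dotV X); rewrite dotBr subr_ge0.
  exact: (dot_averaging_le avgW).
have A0 : A !=set0.
  exists (replicate xo); rewrite /A /Phi /= total_replicate.
  rewrite mulmxBl mul1mx.
  have -> : invmx W *m replicate xo = replicate xo :> 'M[R]_(n, d).
    by rewrite /replicate -{1}(averaging_ones avgW) 2!mulmxA mulVmx// mul1mx.
  by rewrite subrr dot0r mulr0 addr0.
have cPhi : continuous Phi.
  have cid : continuous (@idfun 'M[R]_(n, d)) by move=> ?; exact: cvg_id.
  have cV := continuous_dot cid (@continuous_mulmx _ _ _ _ V).
  have cD (g h : 'M[R]_(n, d) -> R) c : continuous g -> continuous h ->
      continuous (fun X => g X + c * h X).
    by move=> cg ch X; exact: (cvgD (cg X) (cvgM (cvg_cst c) (ch X))).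
  by apply: cD => //; exact: continuous_total.
have clA : closed A.
  exact: (preimage_closed (fun x _ => cPhi x) (@closed_le _ Fmin)).
have a2 : 0 < (2 * alpha)^-1 by rewrite invr_gt0 mulr_gt0.
(* On [A], [D] bounds |deviation|^2, through (1 - gamma) |deviation|^2 <= <X, V X> <= 2 alpha
   [gap_value]. [M] then bounds the objective at the mean by [total_mean_le], with the cross term
   split by Young's inequality and |G|^2 <= 2 L [gap_value]. *)
pose D := 2 * alpha * gap_value / (1 - gamma).
pose M := Fmin + L * gap_value + D / 2 + L / 2 * D.
have [rho rhoP] : exists rho, forall x, \sum_i f i x <= M ->
    dot (x - xo) (x - xo) <= rho.
  apply: (@sublevel_bounded _ _ (fun x => \sum_i f i x)) => //.
    move=> x y t t01; rewrite !mulr_sumr -big_split; apply: ler_sum => i _.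
    exact: convex_functionP.
  apply: (@continuous_sum _ _ _ _ (fun i x => f i x)) => i x.
  exact: differentiable_continuous.
have bndA : exists M', forall X, A X -> dot X X <= M'.
  exists (2 * (D + 2 * (n%:R * rho + n%:R * dot xo xo))) => X.
  rewrite /A /Phi /= => AX.
  have tX : total f X <= Fmin.
    by apply: le_trans _ AX; rewrite lerDl mulr_ge0// ltW.
  have lbX : \sum_i lb i <= total f X by apply: ler_sum => i _; exact: lbf.
  have YD : dot (deviation X) (deviation X) <= D.
    rewrite /D ler_pdivlMr ?subr_gt0// mulrC.
    apply: le_trans (gap_deviation X) _.
    have -> : dot (deviation X) (X - W *m X) = dot X (X - W *m X).
      rewrite dotBl [dot (replicate _) _]dotC dot_replicate ?subr0//.
      rewrite mulmxBr mulmxA -{1}(averaging_sym avgW) -trmx_mul.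
      by rewrite (averaging_ones avgW) subrr.
    apply: le_trans (dotV X) _; rewrite -ler_pdivrMl ?mulr_gt0//.
    by lra.
  have meanM : \sum_i f i (mean X) <= M.
    apply: le_trans (total_mean_le X) _.
    have := dot_gradients_le X LiL sf lbf.
    have := dot_young (gradients f X) (deviation X).
    have LD : L / 2 * dot (deviation X) (deviation X) <= L / 2 * D.
      by rewrite ler_wpM2l// divr_ge0// ltW.
    have : L * (total f X - \sum_i lb i) <= L * gap_value.
      by rewrite ler_pM2l// lerB.
    rewrite /M; lra.
  have -> : X = deviation X + (replicate (mean X - xo) + replicate xo).
    by rewrite -replicateD subrK /deviation subrK.
  apply: le_trans (dot_add_le _ _) _; rewrite ler_pM2l// lerD//.
  apply: le_trans (dot_add_le _ _) _; rewrite ler_pM2l// !dot_replicate_same.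
  by rewrite lerD2r ler_wpM2l// rhoP.
have [X AX Xmin] := EVT_min_mx A0 clA bndA cPhi.
(* Outside [A] the value of [Phi] exceeds [Fmin], so the minimum over [A] is global. *)
have {Xmin} Xmin Z : Phi X <= Phi Z.
  have [/Xmin//|] := leP (Phi Z) Fmin.
  by move/ltW; exact: le_trans AX.
(* [U] is the gradient of [Phi] at X; U = 0 reads X - alpha G = W^-1 X. *)
pose U := gradients f X + alpha^-1 *: (V *m X).
suff /eqP U0 : U == 0.
  exists X; have -> : X - alpha *: gradients f X = invmx W *m X.
    have -> : gradients f X = U - alpha^-1 *: (V *m X) by rewrite /U addrK.
    rewrite U0 sub0r scalerN scalerA divff ?gt_eqF// scale1r opprK.
    by rewrite mulmxBl mul1mx addrC subrK.
  by rewrite mulmxA mulmxV// mul1mx.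
rewrite -dot_eq0; apply/eqP.
have -> : dot U U = dot (gradients f X) U + alpha^-1 * dot U (V *m X).
  by rewrite {1}/U dotDl dotZl (dotC (V *m X)).
(* By the descent lemma, Phi(X + t U) - Phi(X) is at most a quadratic in t with linear coefficient
   |U|^2, and minimality makes it nonnegative for every t. *)
apply: (@quadratic_ge0_linear_coef _ _
  (L / 2 * dot U U + (2 * alpha)^-1 * dot U (V *m U))) => t.
have := Xmin (X + t *: U); rewrite /Phi mulmxDr -scalemxAr.
have := total_descent X (t *: U) sf Li_le.
clearbody U; rewrite !dot_lin.
have -> : dot X (V *m U) = dot U (V *m X) by rewrite dotC dot_mulmxl Vsym.
by rewrite invfM; lra.
Qed.

End FixedPoints.

(** * Choice of the uniform constant and assembly of the bounds *)

Theorem lemma3 (R : realType) (n d : nat) (hn : (2 <= n)%N)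
    (f : 'I_n -> 'cV[R]_d -> R) (Li : 'I_n -> R)
    (hLi : forall i, 0 < Li i)
    (hconvex : forall i, convex_function [set: convex_lmodType 'cV[R]_d] (f i))
    (hsmooth : forall i, smooth (Li i) (f i))
    (hbelow : forall i, exists m : R, forall x, m <= f i x)
    (hopt_nonempty : argmin (fun x => \sum_i f i x) !=set0)
    (hopt_bounded : bounded_set (argmin (fun x => \sum_i f i x))) :
  let Fopt : R := inf (range (fun x => \sum_i f i x)) in
  let L : R := \big[Num.max/0]_i Li i in
  exists C : R, 0 <= C /\
    forall (e : rel 'I_n), symmetric e -> irreflexive e ->
      (forall i j, connect e i j) ->
    forall W : 'M[R]_n, averaging_matrix e W -> posdef W ->
    forall alpha : R, 0 < alpha ->
    [/\ 0 <= beta W < 1,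
        dgd_atc_fixed_points f alpha W !=set0 &
        forall x : 'cV[R]_(n * d), dgd_atc_fixed_points f alpha W x ->
        [/\ stack_fun f x <= Fopt,
            forall i, enorm (block x i - average x)
                        <= C * (alpha / (1 - beta W)) &
            stack_fun f (consensus n (average x))
              <= Fopt + C * (alpha / (1 - beta W)
                   + L * alpha ^+ 2 / (2 * (1 - beta W) ^+ 2))]].
Proof.
move=> Fopt L; have [xo xo_min] := hopt_nonempty.
have [lb lbf] := choice hbelow.
have FoptE : Fopt = \sum_i f i xo.
  apply/eqP; rewrite eq_le; apply/andP; split.
    apply: ge_inf; last by exists xo.
    by exists (\sum_i f i xo) => _ [y _ <-]; exact: xo_min.
  apply: lb_le_inf; first by exists (\sum_i f i xo), xo.
  by move=> _ [y _ <-]; exact: xo_min.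
have LiL i : 0 < Li i <= L by rewrite hLi /L le_bigmax.
have df i y : differentiable (f i) y by case: (hsmooth i).
have L0 : 0 <= L.
  by have /andP[/ltW/le_trans h /h] := LiL (Ordinal (ltnW hn)).
(* [C1] bounds the gradient norm at every fixed point, whatever alpha and W. *)
pose C1 := Num.sqrt (2 * L * (\sum_i f i xo - \sum_i lb i)).
have C10 : 0 <= C1 by exact: sqrtr_ge0.
(* [C1] serves the consensus error; [C1 ^+ 2] serves the objective, where gradient norm times
   deviation and squared deviation appear. *)
exists (C1 + C1 ^+ 2); split; first by rewrite addr_ge0 ?sqr_ge0.
move=> e _ _ conn W avgW posW alpha alpha0.
have /andP[beta0 beta1] := beta_lt1 hn avgW conn posW.
have [gamma [gamma1 gammaW gap]] := averaging_gap avgW conn hn.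
have gamma_beta := gap_le_beta hn avgW gamma1 gammaW.
split; first by rewrite beta0 beta1.
  have [X fixX] := fixed_point_exists hn LiL hsmooth hconvex lbf xo_min
    hopt_bounded avgW posW gamma1 gap alpha0.
  by exists (stack X); apply/(fixed_pointE _ _ _ df); rewrite stackK.
move=> x /(fixed_pointE _ _ _ df); set X := unstack x => fixX.
have FX : stack_fun f x <= Fopt.
  rewrite stack_funE FoptE.
  exact: (fixed_point_total_le hsmooth hconvex xo avgW posW alpha0 fixX).
set b := alpha / (1 - beta W).
have b0 : 0 <= b by rewrite divr_ge0// ?subr_ge0 ltW.
have GC : frob (gradients f X) <= C1.
  exact: (fixed_point_gradients_le hn LiL hsmooth hconvex lbf xo avgW posW
    alpha0 fixX).
have Yb : frob (deviation X) <= C1 * b.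
  rewrite /b mulrA ler_pdivlMr ?subr_gt0//.
  (* Since gamma <= beta, the estimate with 1 - gamma implies the one with 1 - beta. *)
  apply: (le_trans (y := frob (deviation X) * (1 - gamma))).
    by rewrite ler_wpM2l ?frob_ge0// lerD2l lerN2.
  apply: le_trans (fixed_point_deviation_le hn avgW posW gap alpha0 fixX) _.
  by rewrite mulrC ler_pM2r.
split=> // [i|].
  apply: le_trans (block_sub_average x i) (le_trans Yb _).
  by rewrite ler_wpM2r// lerDl sqr_ge0.
rewrite stack_funE unstack_consensus average_unstack.
have -> : total f (replicate (mean X)) = \sum_i f i (mean X).
  by apply: eq_bigr => i _; rewrite row_replicate.
apply: le_trans (total_mean_le LiL hsmooth X) _.
have -> : L * alpha ^+ 2 / (2 * (1 - beta W) ^+ 2) = L / 2 * b ^+ 2.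
  by rewrite /b; field; rewrite subr_eq0 gt_eqF.
move: FX; rewrite stack_funE -/X => FX.
have GY : - dot (gradients f X) (deviation X) <= C1 ^+ 2 * b.
  rewrite -dotNr (le_trans (dot_le_frob _ _))//.
  have -> : frob (- deviation X) = frob (deviation X).
    by rewrite /frob dotNl dotNr opprK.
  by rewrite expr2 -mulrA ler_pM ?frob_ge0.
have YY : L / 2 * dot (deviation X) (deviation X) <= L / 2 * (C1 ^+ 2 * b ^+ 2).
  rewrite ler_wpM2l ?divr_ge0// -sqr_frob -exprMn ler_sqr ?nnegrE ?frob_ge0//.
  by rewrite mulr_ge0.
(* The slack between the factor C1^2 obtained and the announced C1 + C1^2. *)
have : 0 <= C1 * (b + L / 2 * b ^+ 2).
  by rewrite mulr_ge0// addr_ge0// mulr_ge0 ?divr_ge0 ?sqr_ge0.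
lra.
Qed.
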